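(* Let $X$ be a topological space and $S\subseteq\mathbb{TP}(X)$. Then $\underline{\mathrm{tconv}}(S)=[\widehat{\oplus}(S)]$ and $\overline{\mathrm{tconv}}(S)=[\widehat{\boxplus}(S)]$. Moreover, $\overline{\mathrm{tconv}}(\underline{\mathrm{tconv}}(S))=\underline{\mathrm{tconv}}(\overline{\mathrm{tconv}}(S))$, and this set is both lower and upper tropically convex.
   Context: $BC(X)$ is the space of bounded continuous real functions on $X$; $f_1\sim f_2$ if $f_1-f_2$ is constant; $\mathbb{TP}(X)=BC(X)/\sim$, with $[f]$ the class of $f$ and $[V]=\{[f]:f\in V\}$ for $V\subseteq BC(X)$. Metric: $\rho([f],[g])=\sup(g-f)-\inf(g-f)$. For $f$ put $\underline{f}=f-\inf(f)$ and $\overline{f}=f-\sup(f)$. For $\alpha=[f],\beta=[g]$ with $d=\rho(\alpha,\beta)$, the lower tropical segment $\underline{[\alpha,\beta]}$ is the image of $t\mapsto[\min(t,\underline{g-f})+f]$, $t\in[0,d]$, and the upper tropical segment $\overline{[\alpha,\beta]}$ is the image of $t\mapsto[\max(-t,\overline{g-f})+f]$, $t\in[0,d]$. A subset of $\mathbb{TP}(X)$ is lower (resp. upper) tropically convex if it contains the lower (resp. upper) tropical segment between any two of its points. $\underline{\mathrm{tconv}}(S)$ (resp. $\overline{\mathrm{tconv}}(S)$) is the intersection of all lower (resp. upper) tropically convex subsets containing $S$. For $S\subseteq\mathbb{TP}(X)$, let $V_S=\{f\in BC(X):[f]\in S\}$, $\widehat{\oplus}(S)=\{\min(c_1+f_1,\dots,c_m+f_m):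 m\in\mathbb{N}, c_i\in\mathbb{R}, f_i\in V_S\}$ and $\widehat{\boxplus}(S)=\{\max(c_1+f_1,\dots,c_m+f_m): m\in\mathbb{N}, c_i\in\mathbb{R}, f_i\in V_S\}$. *)

(* Defs.v *)
From HB Require Import structures.
From mathcomp Require Import all_boot all_order all_algebra generic_quotient.
From mathcomp Require Import all_classical all_reals all_analysis.

Set Implicit Arguments.
Unset Strict Implicit.
Unset Printing Implicit Defensive.

Import Order.TTheory GRing.Theory Num.Theory.
Import numFieldNormedType.Exports.

Local Open Scope classical_set_scope.
Local Open Scope ring_scope.
Local Open Scope quotient_scope.

Section BC.
Context {R : realType} {X : topologicalType}.

Definition bc_pred : {pred X -> R} :=
  [pred f | `[< continuous f /\ bounded_fun f >]].

Lemma bc_predP (f : X -> R) :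
  reflect (continuous f /\ bounded_fun f) (f \in bc_pred).
Proof. exact: asboolP. Qed.

Lemma bc_boundP (f : X -> R) :
  bounded_fun f <-> exists M, forall x, `|f x| <= M.
Proof.
split=> [[M [_ MP]]|[M MP]].
  by exists (M + 1) => x; apply: (MP (M + 1)); rewrite ?ltrDl.
by exists M; split=> [|N MN x _]; [exact: num_real|exact: le_trans (ltW MN)].
Qed.

Lemma bc_pred_zmod : zmod_closed bc_pred.
Proof.
split=> [|f g /bc_predP[cf /bc_boundP[M fM]] /bc_predP[cg /bc_boundP[N gN]]].
  apply/bc_predP; split; first by move=> x; exact: cvg_cst.
  by apply/bc_boundP; exists 0 => x; rewrite normr0.
apply/bc_predP; split; first by move=> x; apply: cvgB; [exact: cf|exact: cg].
apply/bc_boundP; exists (M + N) => x.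
by rewrite (le_trans (ler_normB _ _))// lerD.
Qed.
HB.instance Definition _ := GRing.isZmodClosed.Build _ bc_pred bc_pred_zmod.

Record BC := MkBC { bc_fun :> X -> R; bc_funP : bc_fun \in bc_pred }.
HB.instance Definition _ := [isSub of BC for bc_fun].
HB.instance Definition _ := [Choice of BC by <:].
HB.instance Definition _ := [SubChoice_isSubZmodule of BC by <:].

Lemma bc_ext (f g : BC) : f =1 g -> f = g.
Proof. by move=> fg; apply: val_inj; apply: funext. Qed.

Lemma bcDE (f g : BC) x : (f + g) x = f x + g x. Proof. by []. Qed.
Lemma bcNE (f : BC) x : (- f) x = - f x. Proof. by []. Qed.

Lemma bc_cst_subproof (c : R) : (fun _ : X => c) \in bc_pred.
Proof.
apply/bc_predP; split; first by move=> x; exact: cvg_cst.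
by apply/bc_boundP; exists `|c|.
Qed.
Definition bc_cst (c : R) : BC := MkBC (bc_cst_subproof c).

Lemma bc_min_subproof (f g : BC) :
  (fun x => Num.min (f x) (g x)) \in bc_pred.
Proof.
have /bc_predP[cf /bc_boundP[M fM]] := bc_funP f.
have /bc_predP[cg /bc_boundP[N gN]] := bc_funP g.
apply/bc_predP; split.
  by move=> x; apply: (@continuous_min R); [exact: cf|exact: cg].
apply/bc_boundP; exists (Num.max M N) => x.
by rewrite minEle le_max; case: ifP; rewrite ?fM ?gN ?orbT.
Qed.
Definition bc_min (f g : BC) : BC := MkBC (bc_min_subproof f g).

Lemma bc_max_subproof (f g : BC) :
  (fun x => Num.max (f x) (g x)) \in bc_pred.
Proof.
have /bc_predP[cf /bc_boundP[M fM]] := bc_funP f.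
have /bc_predP[cg /bc_boundP[N gN]] := bc_funP g.
apply/bc_predP; split.
  by move=> x; apply: (@continuous_max R); [exact: cf|exact: cg].
apply/bc_boundP; exists (Num.max M N) => x.
by rewrite maxEle le_max; case: ifP; rewrite ?fM ?gN ?orbT.
Qed.
Definition bc_max (f g : BC) : BC := MkBC (bc_max_subproof f g).

(* X may be empty; sup set0 = inf set0 = 0, and BC is then a single point. *)
Definition bc_sup (f : BC) : R := sup (range f).
Definition bc_inf (f : BC) : R := inf (range f).

Lemma bc_le_sup (f : BC) x : f x <= bc_sup f.
Proof.
have /bc_predP[_ /bounded_fun_has_ubound ubf] := bc_funP f.
by apply: (ub_le_sup ubf); exists x.
Qed.

Lemma bc_sup_le (f : BC) (M : R) (x0 : X) :
  (forall x, f x <= M) -> bc_sup f <= M.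
Proof.
by move=> fM; apply: ge_sup; [exists (f x0), x0|move=> _ [x _ <-]].
Qed.

Lemma bc_ge_inf (f : BC) x : bc_inf f <= f x.
Proof.
have /bc_predP[_ /bounded_fun_has_lbound lbf] := bc_funP f.
by apply: (ge_inf lbf); exists x.
Qed.

Lemma bc_le_inf (f : BC) (M : R) (x0 : X) :
  (forall x, M <= f x) -> M <= bc_inf f.
Proof.
by move=> fM; apply: lb_le_inf; [exists (f x0), x0|move=> _ [x _ <-]].
Qed.

Lemma bc_supDc (f : BC) (c : R) (x0 : X) :
  bc_sup (f + bc_cst c) = bc_sup f + c.
Proof.
have H (g : BC) d : bc_sup (g + bc_cst d) <= bc_sup g + d.
  by apply: (bc_sup_le x0) => x; rewrite bcDE lerD2r bc_le_sup.
apply/le_anti/andP; split; first exact: H.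
rewrite -lerBrDr -[leLHS](_ : bc_sup ((f + bc_cst c) + bc_cst (- c)) = _).
  exact: H.
by congr bc_sup; apply: bc_ext => x; rewrite !bcDE addrK.
Qed.

Lemma bc_infDc (f : BC) (c : R) (x0 : X) :
  bc_inf (f + bc_cst c) = bc_inf f + c.
Proof.
have H (g : BC) d : bc_inf g + d <= bc_inf (g + bc_cst d).
  by apply: (bc_le_inf x0) => x; rewrite bcDE lerD2r bc_ge_inf.
apply/le_anti/andP; split; last exact: H.
rewrite -lerBlDr -[leRHS](_ : bc_inf ((f + bc_cst c) + bc_cst (- c)) = _).
  exact: H.
by congr bc_inf; apply: bc_ext => x; rewrite !bcDE addrK.
Qed.

Definition bc_lower (f : BC) : BC := f - bc_cst (bc_inf f).
Definition bc_upper (f : BC) : BC := f - bc_cst (bc_sup f).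

Definition bc_eqv (f g : BC) : bool := `[< exists c, f - g = bc_cst c >].

Lemma bc_eqv_refl : reflexive bc_eqv.
Proof. by move=> f; apply/asboolP; exists 0; rewrite subrr; exact: bc_ext. Qed.

Lemma bc_eqv_sym : symmetric bc_eqv.
Proof.
have H f g : bc_eqv f g -> bc_eqv g f.
  move=> /asboolP[c fg]; apply/asboolP; exists (- c); rewrite -opprB fg.
  exact: bc_ext.
by move=> f g; apply/idP/idP; exact: H.
Qed.

Lemma bc_eqv_trans : transitive bc_eqv.
Proof.
move=> g f h /asboolP[c fg] /asboolP[d gh]; apply/asboolP; exists (c + d).
by rewrite -(subrK g f) fg -addrA gh; exact: bc_ext.
Qed.

Canonical bc_equiv := EquivRel bc_eqv bc_eqv_refl bc_eqv_sym bc_eqv_trans.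

Definition TP := {eq_quot bc_equiv}.
HB.instance Definition _ := Choice.on TP.
HB.instance Definition _ := Quotient.on TP.
HB.instance Definition _ := EqQuotient.on TP.

Definition tp_class (f : BC) : TP := \pi_TP f.

Lemma tp_classP (f g : BC) :
  tp_class f = tp_class g <-> exists c, f - g = bc_cst c.
Proof.
split=> [/eqP|fg]; first by rewrite /tp_class eqquotE => /asboolP.
by apply/eqP; rewrite /tp_class eqquotE; apply/asboolP.
Qed.

Lemma tp_classK (a : TP) : tp_class (repr a) = a. Proof. exact: reprK. Qed.

Lemma tp_classDc (f : BC) (c : R) : tp_class (f + bc_cst c) = tp_class f.
Proof. by apply/tp_classP; exists c; rewrite addrC addKr. Qed.

(* The quotient metric and the segments are computed on the canonical
   representatives; rho_class, low_seg_class and up_seg_class below show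
   that any other representatives give the same result. *)
Definition rho (a b : TP) : R :=
  bc_sup (repr b - repr a) - bc_inf (repr b - repr a).

Definition bc_low_seg (f g : BC) : set TP :=
  [set tp_class (bc_min (bc_cst t) (bc_lower (g - f)) + f) |
    t in `[0, rho (tp_class f) (tp_class g)]].

Definition bc_up_seg (f g : BC) : set TP :=
  [set tp_class (bc_max (bc_cst (- t)) (bc_upper (g - f)) + f) |
    t in `[0, rho (tp_class f) (tp_class g)]].

Definition low_seg (a b : TP) : set TP := bc_low_seg (repr a) (repr b).
Definition up_seg (a b : TP) : set TP := bc_up_seg (repr a) (repr b).

Lemma repr_class (f : BC) : exists c, repr (tp_class f) = f + bc_cst c.
Proof.
have [c fc] := (tp_classP (repr (tp_class f)) f).1 (tp_classK _).
by exists c; rewrite -fc addrC subrK.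
Qed.

Lemma bc_subDc (f g : BC) (c d : R) :
  (g + bc_cst d) - (f + bc_cst c) = (g - f) + bc_cst (d - c).
Proof.
apply: bc_ext => x; rewrite !(bcDE, bcNE) /=.
by rewrite opprD addrACA.
Qed.

Lemma bc_lowerDc (f : BC) (c : R) : bc_lower (f + bc_cst c) = bc_lower f.
Proof.
apply: bc_ext => x; rewrite !(bcDE, bcNE) /= bc_infDc//.
by rewrite opprD addrACA subrr addr0.
Qed.

Lemma bc_upperDc (f : BC) (c : R) : bc_upper (f + bc_cst c) = bc_upper f.
Proof.
apply: bc_ext => x; rewrite !(bcDE, bcNE) /= bc_supDc//.
by rewrite opprD addrACA subrr addr0.
Qed.

Lemma rho_class (f g : BC) :
  rho (tp_class f) (tp_class g) = bc_sup (g - f) - bc_inf (g - f).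
Proof.
rewrite /rho; have [c ->] := repr_class f; have [d ->] := repr_class g.
rewrite bc_subDc; have [[x0]|X0] := pselect (inhabited X).
  by rewrite bc_supDc// bc_infDc// opprD addrACA subrr addr0.
suff -> : g - f + bc_cst (d - c) = g - f by [].
by apply: bc_ext => x; case: X0.
Qed.

Lemma low_seg_class (f g : BC) :
  low_seg (tp_class f) (tp_class g) = bc_low_seg f g.
Proof.
rewrite /low_seg /bc_low_seg !tp_classK; apply: eq_imagel => t _.
have [c ->] := repr_class f; have [d ->] := repr_class g.
by rewrite bc_subDc bc_lowerDc addrA tp_classDc.
Qed.

Lemma up_seg_class (f g : BC) :
  up_seg (tp_class f) (tp_class g) = bc_up_seg f g.
Proof.
rewrite /up_seg /bc_up_seg !tp_classK; apply: eq_imagel => t _.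
have [c ->] := repr_class f; have [d ->] := repr_class g.
by rewrite bc_subDc bc_upperDc addrA tp_classDc.
Qed.

Definition low_tconvex (S : set TP) : Prop :=
  forall a b, S a -> S b -> low_seg a b `<=` S.

Definition up_tconvex (S : set TP) : Prop :=
  forall a b, S a -> S b -> up_seg a b `<=` S.

Definition low_tconv (S : set TP) : set TP := smallest low_tconvex S.
Definition up_tconv (S : set TP) : set TP := smallest up_tconvex S.

(* Since min and max have no neutral element on BC, the iteration over the
   nonempty range 'I_m.+1 starts from the first term, which is harmless by
   idempotence. *)
Definition bc_minn m (h : 'I_m.+1 -> BC) : BC :=
  \big[bc_min/h ord0]_(i < m.+1) h i.

Definition bc_maxn m (h : 'I_m.+1 -> BC) : BC :=
  \big[bc_max/h ord0]_(i < m.+1) h i.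

Lemma bc_minnE m (h : 'I_m.+1 -> BC) x :
  bc_minn h x = \big[Num.min/h ord0 x]_(i < m.+1) h i x.
Proof. by rewrite /bc_minn; elim/big_rec2: _ => //= i y f _ ->. Qed.

Lemma bc_maxnE m (h : 'I_m.+1 -> BC) x :
  bc_maxn h x = \big[Num.max/h ord0 x]_(i < m.+1) h i x.
Proof. by rewrite /bc_maxn; elim/big_rec2: _ => //= i y f _ ->. Qed.

Definition low_comb (S : set TP) : set BC :=
  [set h | exists (m : nat) (c : 'I_m.+1 -> R) (f : 'I_m.+1 -> BC),
    (forall i, (tp_class @^-1` S) (f i)) /\
    h = bc_minn (fun i => bc_cst (c i) + f i)].

Definition up_comb (S : set TP) : set BC :=
  [set h | exists (m : nat) (c : 'I_m.+1 -> R) (f : 'I_m.+1 -> BC),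
    (forall i, (tp_class @^-1` S) (f i)) /\
    h = bc_maxn (fun i => bc_cst (c i) + f i)].

End BC.
Arguments BC R X : clear implicits.
Arguments TP R X : clear implicits.

(* Main.v *)
Require Import Defs.
From mathcomp Require Import all_boot all_order all_algebra.
From mathcomp Require Import all_classical all_reals all_analysis.
Local Open Scope classical_set_scope.

(* A set of classes is lower (upper) tropically convex exactly when its preimage
   in BC(X) is closed under pointwise min (max): up to an additive constant, the
   points of the segment between [f] and [g] are the functions min(f, g + c).
   The hulls are therefore closures under an associative, commutative, idempotent
   operation, which are given by iterating that operation, and the two closures
   commute because min and max distribute over each other. *)

Set Implicit Arguments.
Unset Strict Implicit.
Unset Printing Implicit Defensive.

Import Order.TTheory GRing.Theory Num.Theory.
Local Open Scope ring_scope.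

(** * Closures under a binary operation *)

Section OpClosure.
Context {T : Type}.
Implicit Types (op : T -> T -> T) (W : set T).

Definition op_closed op W := forall u v, W u -> W v -> W (op u v).

Definition op_span op W : set T :=
  [set u | exists (m : nat) (h : 'I_m.+1 -> T),
    (forall i, W (h i)) /\ u = \big[op/h ord0]_(i < m.+1) h i].

Lemma smallest_op_closed op W : op_closed op (smallest (op_closed op) W).
Proof.
by move=> u v Wu Wv A AP; apply: AP.1; [exact: Wu|exact: Wv].
Qed.

(** With one argument of [op] fixed, distributivity makes the other arguments that land in the
    closure an [op']-closed set, so it suffices to test generators. This is done in the right
    argument first, with a generator on the left, then in the left argument. *)
Lemma smallest_op_closed_distr op op' W :
  right_distributive op op' -> left_distributive op op' -> op_closed op W ->
  op_closed op (smallest (op_closed op') W).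
Proof.
move=> opDr opDl cW u v Mu Mv; set M := smallest _ _ in Mu Mv *.
have cM : op_closed op' M := @smallest_op_closed _ _.
have WM w (Mw : M w) : W `<=` [set a | M (op a w)].
  move=> a Wa; suff : M `<=` [set b | M (op a b)] by apply.
  apply: smallest_sub => [b b' /= Mb Mb'|b Wb]; first by rewrite opDr; exact: cM.
  by apply: sub_gen_smallest; exact: cW.
suff : M `<=` [set a | M (op a v)] by apply.
apply: smallest_sub => [a a' /= Ma Ma'|]; last exact: WM.
by rewrite opDl; exact: cM.
Qed.

Section Span.
Context (op : T -> T -> T).
Hypotheses (opA : associative op) (opC : commutative op) (opxx : idempotent_op op).

(** Without a neutral element the starting value of an iteration matters; this moves an outer
    operand in and out of it. *)
Lemma big_op_idx (I : Type) (r : seq I) (F : I -> T) x z :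
  op x (\big[op/z]_(i <- r) F i) = \big[op/op x z]_(i <- r) F i.
Proof.
elim: r => [|i r IHr]; first by rewrite !big_nil.
by rewrite !big_cons -IHr !opA (opC x).
Qed.

Lemma op_span_cons W u v : W u -> op_span op W v -> op_span op W (op u v).
Proof.
move=> Wu [m [h [Wh ->]]].
exists m.+1, (fun i => oapp h u (unlift ord0 i)); split.
  by move=> i; case: unliftP => [j|] _ /=.
(* The term [h ord0] already occurs in the iteration, so idempotence absorbs a further copy. This
   reconciles the old starting value [h ord0] with the new one, [u]. *)
have h0 z : op (h ord0) (\big[op/z]_(i < m.+1) h i) = \big[op/z]_(i < m.+1) h i.
  by rewrite big_ord_recl opA opxx.
rewrite [RHS]big_ord_recl unlift_none; under [in RHS]eq_bigr do rewrite liftK.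
rewrite /=.
by rewrite !big_op_idx opxx (opC u) -big_op_idx h0.
Qed.

Lemma op_closed_span W : op_closed op (op_span op W).
Proof.
(* Induction on the iteration giving the first argument. The second argument [v] stays general,
   since associativity turns [op (op x y) v] into [op x (op y v)]. *)
move=> _ v [m [h [Wh ->]]]; move: v.
elim/big_ind: _ => [|x y Px Py v Wv|i _] => [v Wv||v Wv].
- exact: op_span_cons.
- by rewrite -opA; apply: Px; exact: Py.
- exact: op_span_cons.
Qed.

Lemma op_spanE W : op_span op W = smallest (op_closed op) W.
Proof.
apply/seteqP; split=> [_ [m [h [Wh ->]]]|].
  have Mh i : smallest (op_closed op) W (h i) by exact: sub_gen_smallest.
  by elim/big_ind: _ => //; exact: smallest_op_closed.
apply: smallest_sub; first exact: op_closed_span.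
move=> u Wu; exists 0%N, (fun=> u); split=> //.
by rewrite big_ord_recl big_ord0 opxx.
Qed.

End Span.
End OpClosure.

(** * Tropical hulls as closures of translation-invariant sets of functions *)

Section TropicalHulls.
Context {R : realType} {X : topologicalType}.
Implicit Types (S C : set (TP R X)) (f g u v : BC R X).

Definition op_tconvex (op : BC R X -> BC R X -> BC R X) C :=
  op_closed op (tp_class @^-1` C).

(** Lets hulls be computed on functions instead of classes. As [op] commutes with adding constants,
    the closure of a translation-invariant set is again translation-invariant, hence is the full
    preimage of a set of classes. *)
Lemma preimage_op_tconv op S :
  (forall u v c, op (u + bc_cst c) (v + bc_cst c) = op u v + bc_cst c) ->
  tp_class @^-1` smallest (op_tconvex op) S =
    smallest (op_closed op) (tp_class @^-1` S).
Proof.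
move=> opDc; set M := RHS.
have cM : op_closed op M := @smallest_op_closed _ _ _.
have MDc c : M `<=` [set u | M (u + bc_cst c)].
  apply: smallest_sub => [u v /= Mu Mv|u Su]; first by rewrite -opDc; exact: cM.
  by apply: sub_gen_smallest; rewrite /preimage /= tp_classDc.
have Mclass : tp_class @^-1` (tp_class @` M) = M.
  apply/seteqP; split=> [u [v Mv /esym /tp_classP[c uv]]|u Mu]; last by exists u.
  by rewrite -(subrK v u) uv addrC; exact: MDc.
apply/seteqP; split=> [u Su|].
  rewrite -Mclass; apply: Su; split; first by rewrite /= /op_tconvex Mclass.
  move=> a Sa; exists (repr a); last exact: tp_classK.
  by apply: sub_gen_smallest; rewrite /preimage /= tp_classK.
apply: smallest_sub => [u v Su Sv C CP|u Su]; last exact: sub_gen_smallest.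
by apply: CP.1; [exact: Su|exact: Sv].
Qed.

Lemma op_tconvE op S :
  associative op -> commutative op -> idempotent_op op ->
  (forall u v c, op (u + bc_cst c) (v + bc_cst c) = op u v + bc_cst c) ->
  smallest (op_tconvex op) S = tp_class @` op_span op (tp_class @^-1` S).
Proof.
move=> opA opC opxx opDc; rewrite op_spanE// -preimage_op_tconv//.
apply/seteqP; split=> [a Sa|_ [u Su <-]//].
by exists (repr a); rewrite /preimage /= ?tp_classK.
Qed.

Lemma op_tconvex_tconv op op' S :
  right_distributive op op' -> left_distributive op op' ->
  (forall u v c, op' (u + bc_cst c) (v + bc_cst c) = op' u v + bc_cst c) ->
  op_tconvex op S -> op_tconvex op (smallest (op_tconvex op') S).
Proof.
move=> opDr opDl opDc cS; rewrite /op_tconvex preimage_op_tconv//.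
exact: smallest_op_closed_distr.
Qed.

Lemma bc_cstE c (x : X) : bc_cst c x = c :> R. Proof. by []. Qed.
Lemma bc_minE f g x : bc_min f g x = Num.min (f x) (g x). Proof. by []. Qed.
Lemma bc_maxE f g x : bc_max f g x = Num.max (f x) (g x). Proof. by []. Qed.
Definition bcE := (@bcDE R X, @bcNE R X, bc_cstE, bc_minE, bc_maxE).

Lemma bc_minA : associative (@bc_min R X).
Proof. by move=> f g h; apply: bc_ext => x /=; rewrite minA. Qed.
Lemma bc_minC : commutative (@bc_min R X).
Proof. by move=> f g; apply: bc_ext => x /=; rewrite minC. Qed.
Lemma bc_minxx : idempotent_op (@bc_min R X).
Proof. by move=> f; apply: bc_ext => x /=; rewrite minxx. Qed.
Lemma bc_minDc f g c :
  bc_min (f + bc_cst c) (g + bc_cst c) = bc_min f g + bc_cst c.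
Proof. by apply: bc_ext => x; rewrite !bcE addr_minl. Qed.

Lemma bc_maxA : associative (@bc_max R X).
Proof. by move=> f g h; apply: bc_ext => x /=; rewrite maxA. Qed.
Lemma bc_maxC : commutative (@bc_max R X).
Proof. by move=> f g; apply: bc_ext => x /=; rewrite maxC. Qed.
Lemma bc_maxxx : idempotent_op (@bc_max R X).
Proof. by move=> f; apply: bc_ext => x /=; rewrite maxxx. Qed.
Lemma bc_maxDc f g c :
  bc_max (f + bc_cst c) (g + bc_cst c) = bc_max f g + bc_cst c.
Proof. by apply: bc_ext => x; rewrite !bcE addr_maxl. Qed.

Lemma bc_min_maxr : right_distributive (@bc_min R X) bc_max.
Proof. by move=> f g h; apply: bc_ext => x /=; rewrite min_maxr. Qed.
Lemma bc_min_maxl : left_distributive (@bc_min R X) bc_max.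
Proof. by move=> f g h; apply: bc_ext => x /=; rewrite min_maxl. Qed.
Lemma bc_max_minr : right_distributive (@bc_max R X) bc_min.
Proof. by move=> f g h; apply: bc_ext => x /=; rewrite max_minr. Qed.
Lemma bc_max_minl : left_distributive (@bc_max R X) bc_min.
Proof. by move=> f g h; apply: bc_ext => x /=; rewrite max_minl. Qed.

Lemma tp_class_cstD c f : tp_class (bc_cst c + f) = tp_class f.
Proof. by rewrite addrC tp_classDc. Qed.

(* [min(f, g)] is the point of parameter [- inf (g - f)] of the lower segment;
   this parameter is out of range only when [f] and [g] are comparable. *)
Lemma low_tconvexE : @low_tconvex R X = op_tconvex bc_min.
Proof.
apply/funext => C; apply/propext; split=> [cC f g Cf Cg|cC a b Ca Cb].
  have [i0|i0] := ltP 0 (bc_inf (g - f)).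
    rewrite (_ : bc_min f g = f)//; apply: bc_ext => x /=; apply/min_idPl.
    by rewrite -subr_ge0 (le_trans (ltW i0) (bc_ge_inf (g - f) x)).
  have [s0|s0] := ltP (bc_sup (g - f)) 0.
    rewrite (_ : bc_min f g = g)//; apply: bc_ext => x /=; apply/min_idPr.
    by rewrite -subr_le0 (le_trans (bc_le_sup (g - f) x) (ltW s0)).
  (* Now the infimum is at most 0 and the supremum at least 0, which puts the parameter in range. An
     empty [X] falls into this case, both values being 0 by default. *)
  apply: (cC _ _ Cf Cg); rewrite low_seg_class; exists (- bc_inf (g - f)).
    by rewrite /= in_itv /= rho_class oppr_ge0 i0 lerDr.
  rewrite -(tp_classDc (bc_min f g) (- bc_inf (g - f))); congr tp_class.
  apply: bc_ext => x; rewrite /bc_lower /bc_upper !bcE.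
  by rewrite !addr_minl [- _ + f x]addrC addrAC subrK.
rewrite -(tp_classK a) -(tp_classK b) low_seg_class => _ [t _ <-].
set f := repr a; set g := repr b.
(* Adding [f] inside the minimum shows the segment point as a minimum of translates of [f] and [g],
   whose classes are still in [C]. *)
rewrite (_ : _ + f = bc_min (bc_cst t + f) (bc_cst (- bc_inf (g - f)) + g)).
  by apply: cC; rewrite /preimage /= tp_class_cstD tp_classK.
apply: bc_ext => x; rewrite /bc_lower /bc_upper !bcE.
by rewrite !addr_minl addrAC subrK [- _ + g x]addrC.
Qed.

(** Dually, the class of [bc_max f g] is the point of parameter [bc_sup (g - f)] of the upper
    segment, out of range only when [f] and [g] are comparable. *)
Lemma up_tconvexE : @up_tconvex R X = op_tconvex bc_max.
Proof.
apply/funext => C; apply/propext; split=> [cC f g Cf Cg|cC a b Ca Cb].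
  have [i0|i0] := ltP 0 (bc_inf (g - f)).
    rewrite (_ : bc_max f g = g)//; apply: bc_ext => x /=; apply/max_idPr.
    by rewrite -subr_ge0 (le_trans (ltW i0) (bc_ge_inf (g - f) x)).
  have [s0|s0] := ltP (bc_sup (g - f)) 0.
    rewrite (_ : bc_max f g = f)//; apply: bc_ext => x /=; apply/max_idPl.
    by rewrite -subr_le0 (le_trans (bc_le_sup (g - f) x) (ltW s0)).
  apply: (cC _ _ Cf Cg); rewrite up_seg_class; exists (bc_sup (g - f)).
    by rewrite /= in_itv /= rho_class s0 lerDl oppr_ge0.
  rewrite -(tp_classDc (bc_max f g) (- bc_sup (g - f))); congr tp_class.
  apply: bc_ext => x; rewrite /bc_lower /bc_upper !bcE.
  by rewrite !addr_maxl [- _ + f x]addrC addrAC subrK.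
rewrite -(tp_classK a) -(tp_classK b) up_seg_class => _ [t _ <-].
set f := repr a; set g := repr b.
rewrite (_ : _ + f = bc_max (bc_cst (- t) + f) (bc_cst (- bc_sup (g - f)) + g)).
  by apply: cC; rewrite /preimage /= tp_class_cstD tp_classK.
apply: bc_ext => x; rewrite /bc_lower /bc_upper !bcE.
by rewrite !addr_maxl addrAC subrK [- _ + g x]addrC.
Qed.

(** The preimage of [S] absorbs the coefficients [c i], and zero coefficients recover the plain
    span. For [bc_min] and [bc_max] the right-hand side unfolds to [low_comb S] and [up_comb S]. *)
Lemma op_span_cst op S :
  op_span op (tp_class @^-1` S) =
  [set h | exists (m : nat) (c : 'I_m.+1 -> R) (f : 'I_m.+1 -> BC R X),
    (forall i, (tp_class @^-1` S) (f i)) /\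
    h = \big[op/bc_cst (c ord0) + f ord0]_(i < m.+1) (bc_cst (c i) + f i)].
Proof.
apply/seteqP; split=> [_ [m [h [Sh ->]]]|_ [m [c [f [Sf ->]]]]].
  have h0 i : bc_cst 0 + h i = h i by apply: bc_ext => x; rewrite !bcE add0r.
  exists m, (fun=> 0), h; split=> //; rewrite h0.
  by apply: eq_bigr => i _; rewrite h0.
exists m, (fun i => bc_cst (c i) + f i); split=> // i.
by rewrite /preimage /= tp_class_cstD; exact: Sf.
Qed.

Lemma op_tconvex_smallest op S : op_tconvex op (smallest (op_tconvex op) S).
Proof. by move=> u v Su Sv C CP; apply: CP.1; [exact: Su|exact: Sv]. Qed.

End TropicalHulls.

Theorem theorem3p17 (R : realType) (X : topologicalType) (S : set (TP R X)) :
  low_tconv S = tp_class @` low_comb S /\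
  up_tconv S = tp_class @` up_comb S /\
  up_tconv (low_tconv S) = low_tconv (up_tconv S) /\
  low_tconvex (up_tconv (low_tconv S)) /\
  up_tconvex (up_tconv (low_tconv S)).
Proof.
rewrite /low_tconv /up_tconv low_tconvexE up_tconvexE.
have low_up : op_tconvex bc_min
    (smallest (op_tconvex bc_max) (smallest (op_tconvex bc_min) S)).
  apply: op_tconvex_tconv; [exact: bc_min_maxr|exact: bc_min_maxl|exact: bc_maxDc|].
  exact: op_tconvex_smallest.
have up_low : op_tconvex bc_max
    (smallest (op_tconvex bc_min) (smallest (op_tconvex bc_max) S)).
  apply: op_tconvex_tconv; [exact: bc_max_minr|exact: bc_max_minl|exact: bc_minDc|].
  exact: op_tconvex_smallest.
split; [|split; [|split; [|split]]] => //; last exact: op_tconvex_smallest.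
- rewrite op_tconvE ?op_span_cst//.
  + exact: bc_minA.
  + exact: bc_minC.
  + exact: bc_minxx.
  + exact: bc_minDc.
- rewrite op_tconvE ?op_span_cst//.
  + exact: bc_maxA.
  + exact: bc_maxC.
  + exact: bc_maxxx.
  + exact: bc_maxDc.
have Sgen op op' : S `<=` smallest (op_tconvex op) (smallest (op_tconvex op') S).
  apply: (@subset_trans _ (smallest (op_tconvex op') S)); exact: sub_gen_smallest.
(* Each iterated hull contains [S] and is closed under both operations, so minimality of the outer
   and then of the inner hull gives each inclusion. *)
apply/seteqP; split; apply: smallest_sub => //; apply: smallest_sub => //;
  exact: op_tconvex_smallest.
Qed.
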